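(* Let $\Pi$ be a bicriteria minimization problem with positive-valued, polynomially computable objective functions. Given $0<\epsilon\leq 1$ and a polynomial-time exact algorithm $\mathrm{ALG}$ for the weighted sum problem $\Pi^{\mathrm{WS}}$, it is possible to obtain a bicriteria $\left(1+2\epsilon,\ 1+\frac{2}{\epsilon}\right)$-approximation algorithm for the budget-constrained problem $\Pi^{\mathrm{Budget}}$ with running time $\mathcal{O}\left(T_{\mathrm{ALG}}\cdot\log_2\left(\frac{1}{\epsilon}\cdot\log_2\left(\frac{\mathrm{UB}(2)}{\mathrm{LB}(2)}\right)\right)\right)$, where $T_{\mathrm{ALG}}$ denotes the running time of $\mathrm{ALG}$.
   Context: Bicriteria minimization problem $\Pi$: each instance $I$ has a set $S(I)$ of feasible solutions, and two objective functions to be minimized are given by polynomial-time algorithms $f_1,f_2$ that, given $I$ and $x\in S(I)$, compute positive rational numbers $f_1(I,x), f_2(I,x)$. For each instance $I$ and $i=1,2$ there are positive rationals $\mathrm{LB}(I,i),\mathrm{UB}(I,i)$, of encoding length polynomial in the encoding length $|I|$, with $\mathrm{LB}(I,i)\le f_i(I,x)\le \mathrm{UB}(I,i)$ for all $x\in S(I)$; these bounds may be used by the algorithms. The instance $I$ is dropped from the notation when clear (so $\mathrm{LB}(i)=\mathrm{LB}(I,i)$, $\mathrm{UB}(i)=\mathrm{UB}(I,i)$). Weighted sum problem $\Pi^{\mathrm{WS}}$: given an instance $I$ and a weight $\gamma>0$, find $x\in S(I)$ minimizing $f_1(I,x)+\gamma\cdot f_2(I,x)$ over $S(I)$. A polynomial-time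 exact algorithm for it is an algorithm that, in polynomial time, returns an optimal solution if a feasible solution exists and outputs infeasibility otherwise. Budget-constrained problem $\Pi^{\mathrm{Budget}}$: given an instance $I$ of $\Pi$ and a budget $B>0$, find $x\in S(I)$ with $f_1(I,x)\le B$ minimizing $f_2(I,x)$ among all such solutions. (Polynomial-time) bicriteria $(\alpha',\beta')$-approximation algorithm ($\alpha',\beta'\ge1$) for $\Pi^{\mathrm{Budget}}$: an algorithm that, for any instance $I$ of $\Pi$ and any budget $B>0$, requires time polynomial in the encoding length of $I,B$ to find a solution $x\in S(I)$ such that: if there exists $x'\in S(I)$ with $f_1(I,x')\le B$, then $f_1(I,x)\le\alpha'\cdot B$ and $f_2(I,x)\le\beta'\cdot\mathrm{opt}(B)$, where $\mathrm{opt}(B)=\inf\{f_2(I,\tilde x):\tilde x\in S(I),\ f_1(I,\tilde x)\le B\}$.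
   Formalization: The running time bound counts T_ALG plus the time to evaluate the objective functions at solutions returned by ALG (not dominated by T_ALG in general), and the logarithmic factor is replaced by its maximum with 1, since it is undefined when UB(2)=LB(2). *)

(* Defs.v *)
From HB Require Import structures.
From mathcomp Require Import all_boot all_order all_algebra.
From mathcomp Require Import all_classical all_reals all_analysis.
Set Implicit Arguments.
Unset Strict Implicit.
Unset Printing Implicit Defensive.
Import Order.TTheory GRing.Theory Num.Theory.
Local Open Scope classical_set_scope.
Local Open Scope ring_scope.

(** * Model of computation

    Algorithms are programs of a small deterministic language over binary trees
    with rational leaves, with logarithmic costs: every elementary operation is
    charged the encoding lengths of its argument and of its result.  In
    particular a program is always charged for reading its input and for
    writing its output ([t >= dsize v] and [t >= dsize w] when [run p v w t]).
    Up to polynomial factors this is Turing machine time: a tree of rationals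
    of encoding length [n] is a string of length [O(n)] on which each elementary
    operation is polynomial-time, and a machine with two stacks is simulated
    with polynomial overhead. *)

Inductive data : Type :=
| Atom of rat
| Node of data & data.

Definition bitlen (n : nat) : nat := (trunc_log 2 n).+1.

(** Sign, numerator and denominator in lowest terms, in binary. *)
Definition qsize (q : rat) : nat := (1 + bitlen `|numq q| + bitlen `|denq q|)%N.

Fixpoint dsize (v : data) : nat :=
  match v with
  | Atom q => qsize q
  | Node u w => (1 + dsize u + dsize w)%N
  end.

Inductive prim : Type :=
| PId
| PConst of rat
| PFst | PSnd
| PIsNode
| PAdd | PSub | PMul | PDiv | PLeq
| PFloor.

Definition bool_val (b : bool) : data := Atom (b%:R).

(** Operations applied to a value of the wrong shape return [Atom 0]. *)
Definition eval_prim (o : prim) (v : data) : data :=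
  match o, v with
  | PId, _ => v
  | PConst q, _ => Atom q
  | PFst, Node u _ => u
  | PSnd, Node _ w => w
  | PIsNode, Node _ _ => bool_val true
  | PAdd, Node (Atom a) (Atom b) => Atom (a + b)
  | PSub, Node (Atom a) (Atom b) => Atom (a - b)
  | PMul, Node (Atom a) (Atom b) => Atom (a * b)
  | PDiv, Node (Atom a) (Atom b) => Atom (a / b)
  | PLeq, Node (Atom a) (Atom b) => bool_val (a <= b)
  | PFloor, Atom a => Atom ((Num.floor a)%:~R)
  | _, _ => Atom 0
  end.

Inductive prog : Type :=
| Prim of prim
| Seq of prog & prog
| Fork of prog & prog
| If of prog & prog & prog
| While of prog & prog.

Definition truthy (v : data) : bool := if v is Atom q then q != 0 else true.

(** [run p v w t]: on input [v], the program [p] halts with output [w] after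
    time [t]. *)
Inductive run : prog -> data -> data -> nat -> Prop :=
| RunPrim o v :
    run (Prim o) v (eval_prim o v) (1 + dsize v + dsize (eval_prim o v))
| RunSeq p q v u w s t :
    run p v u s -> run q u w t -> run (Seq p q) v w (1 + s + t)
| RunFork p q v u w s t :
    run p v u s -> run q v w t -> run (Fork p q) v (Node u w) (1 + s + t)
| RunIfTrue c p q v b w s t :
    run c v b s -> truthy b -> run p v w t -> run (If c p q) v w (1 + s + t)
| RunIfFalse c p q v b w s t :
    run c v b s -> ~~ truthy b -> run q v w t -> run (If c p q) v w (1 + s + t)
| RunWhileTrue c p v b u w s t r :
    run c v b s -> truthy b -> run p v u t -> run (While c p) u w r ->
    run (While c p) v w (1 + s + t + r)
| RunWhileFalse c p v b s :
    run c v b s -> ~~ truthy b -> run (While c p) v v (1 + s).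

(** * Bicriteria minimization problems *)

Inductive criterion : Type := crit1 | crit2.

(** Instances and solutions are identified with their encodings. *)
Record biproblem : Type := Biproblem {
  instance : set data;
  feasible : data -> set data;
  obj : criterion -> data -> data -> rat;
  obj_prog : criterion -> prog;
  LB : data -> criterion -> rat;
  UB : data -> criterion -> rat;
  obj_gt0 : forall i I x, instance I -> feasible I x -> 0 < obj i I x;
  obj_polytime : exists pol : {poly nat}, forall i I x,
    instance I -> feasible I x ->
    exists2 t, run (obj_prog i) (Node I x) (Atom (obj i I x)) t
             & (t <= pol.[dsize I + dsize x])%N;
  LB_gt0 : forall I i, instance I -> 0 < LB I i;
  UB_gt0 : forall I i, instance I -> 0 < UB I i;
  bounds_size : exists pol : {poly nat}, forall I i, instance I ->
    (qsize (LB I i) <= pol.[dsize I])%N /\ (qsize (UB I i) <= pol.[dsize I])%N;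
  obj_bounds : forall i I x, instance I -> feasible I x ->
    LB I i <= obj i I x <= UB I i
}.

(** The bounds are only assumed to exist, not to be computable; the algorithms
    may use them because they receive them along with the instance. *)
Definition instance_input (Pi : biproblem) (I : data) : data :=
  Node I (Node (Node (Atom (LB Pi I crit1)) (Atom (UB Pi I crit1)))
               (Node (Atom (LB Pi I crit2)) (Atom (UB Pi I crit2)))).

(** Last component: the weight for the weighted sum problem, the budget for
    the budget-constrained problem. *)
Definition param_input (Pi : biproblem) (I : data) (q : rat) : data :=
  Node (instance_input Pi I) (Atom q).

(** [None] stands for the answer "infeasible". *)
Definition answer (o : option data) : data :=
  if o is Some x then Node (Atom 0) x else Atom 0.

Definition weighted_sum (Pi : biproblem) (I : data) (gamma : rat) (x : data) : rat :=
  obj Pi crit1 I x + gamma * obj Pi crit2 I x.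

Definition ws_correct (Pi : biproblem) (I : data) (gamma : rat)
    (o : option data) : Prop :=
  match o with
  | Some x => feasible Pi I x /\
      forall y, feasible Pi I y ->
        weighted_sum Pi I gamma x <= weighted_sum Pi I gamma y
  | None => feasible Pi I = set0
  end.

Definition ws_exact_polytime (Pi : biproblem) (alg : prog) : Prop :=
  exists pol : {poly nat}, forall I gamma, instance Pi I -> 0 < gamma ->
  exists o t, [/\ run alg (param_input Pi I gamma) (answer o) t,
                  (t <= pol.[dsize I + qsize gamma])%N
                & ws_correct Pi I gamma o].

(** A real infimum: only meaningful when some feasible solution respects the
    budget. *)
Definition opt (R : realType) (Pi : biproblem) (I : data) (B : rat) : R :=
  inf [set ratr (obj Pi crit2 I x) | x in
        [set x | feasible Pi I x /\ obj Pi crit1 I x <= B]].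

Definition budget_correct (R : realType) (alpha beta : R) (Pi : biproblem)
    (I : data) (B : rat) (o : option data) : Prop :=
  match o with
  | Some x => feasible Pi I x /\
      ((exists2 y, feasible Pi I y & obj Pi crit1 I y <= B) ->
       ratr (obj Pi crit1 I x) <= alpha * ratr B /\
       ratr (obj Pi crit2 I x) <= beta * opt R Pi I B)
  | None => feasible Pi I = set0
  end.

Definition bicriteria_approx (R : realType) (alpha beta : R) (Pi : biproblem)
    (alg : prog) : Prop :=
  [/\ 1 <= alpha, 1 <= beta &
   exists pol : {poly nat}, forall I B, instance Pi I -> 0 < B ->
   exists o t, [/\ run alg (param_input Pi I B) (answer o) t,
                   (t <= pol.[dsize I + qsize B])%N
                 & budget_correct alpha beta Pi I B o]].

(** * Running times *)

(** Worst-case running time of [alg] for the weighted sum problem on [I], over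
    the weights of encoding length at most [l].  For an algorithm as above, these
    times are bounded, so that the supremum is a genuine one. *)
Definition T_ALG (R : realType) (Pi : biproblem) (alg : prog) (I : data) (l : R) : R :=
  sup [set T | exists gamma w t,
         [/\ 0 < gamma, (qsize gamma)%:R <= l,
             run alg (param_input Pi I gamma) w t & T = t%:R]].

(** Worst-case time for evaluating an objective function at a solution returned
    by [alg] on [I], over the same weights. *)
Definition T_obj (R : realType) (Pi : biproblem) (alg : prog) (I : data) (l : R) : R :=
  sup [set T | exists gamma x s i w t,
         [/\ 0 < gamma /\ (qsize gamma)%:R <= l,
             run alg (param_input Pi I gamma) (answer (Some x)) s,
             run (obj_prog Pi i) (Node I x) w t & T = t%:R]].

Definition log2 (R : realType) (x : R) : R := ln x / ln 2.

(** The maximum with 1 is the usual reading of [O(T * log2 z)] when [log2 z] is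
    small, negative or (for [UB = LB]) undefined; [ln] is 0 on nonpositive
    arguments. *)
Definition log_factor (R : realType) (Pi : biproblem) (eps : R) (I : data) : R :=
  Num.max 1 (log2 (1 / eps * log2 (ratr (UB Pi I crit2 / LB Pi I crit2)))).

(* Main.v *)
Require Import Defs.
From HB Require Import structures.
From mathcomp Require Import all_boot all_order all_algebra.
From mathcomp Require Import all_classical all_reals all_analysis.
From mathcomp Require Import zify ring lra.
Set Implicit Arguments.
Unset Strict Implicit.
Unset Printing Implicit Defensive.
Import Order.TTheory GRing.Theory Num.Theory.
Local Open Scope ring_scope.

(** Let [y] respect the budget and let [gamma = delta * B / f2 y].  A minimizer [x]
    of [f1 + gamma * f2] satisfies [f1 x <= (1 + delta) * B] and
    [f2 x <= (1 + 1 / delta) * f2 y], so every [delta] in [[eps / 2, 2 * eps]] is good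
    enough.  Choosing [2 ^- e] in [[eps / 2, eps]], some weight of the grid
    [2 ^- e * B / UB(2) * 2 ^+ j] is therefore good, with [j] at most about
    [log2 (UB(2) / LB(2))], and a binary search for the largest [j] whose solution
    has [f1 <= (1 + 2 * 2 ^- e) * B] takes [log2 (log2 (UB(2) / LB(2))) + O(1)] calls.
    The search never handles [j] itself: the numbers [2 ^+ (2 ^ i)] are pushed on a
    stack by repeated squaring until they exceed [UB(2) / LB(2)], then popped, each
    multiplying the current weight if the solution for the product passes the test.

    All numbers involved have encoding length linear in the input and [log2 (1 / eps)],
    so the bookkeeping is linear in that quantity for each call.  It is absorbed by
    [T_ALG] because [ALG] has to read a weight such as [2 ^+ m] in full. *)

(** * Encoding lengths *)

Lemma leq_bitlen m n : (m <= n)%N -> (bitlen m <= bitlen n)%N.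
Proof. by move=> le_mn; rewrite ltnS leq_trunc_log. Qed.

Lemma bitlenM m n : (bitlen (m * n) <= bitlen m + bitlen n)%N.
Proof.
rewrite /bitlen; have [->|mn_gt0] := posnP (m * n)%N.
  by rewrite trunc_log0 addSn.
rewrite -(@ltn_exp2l 2) // (leq_ltn_trans (trunc_logP _ _)) // expnD.
by rewrite ltn_mul // trunc_log_ltn.
Qed.

Lemma bitlenX n : bitlen (2 ^ n) = n.+1.
Proof. by rewrite /bitlen trunc_expnK. Qed.

Lemma qsize_gt2 q : (3 <= qsize q)%N.
Proof. by rewrite /qsize /bitlen; lia. Qed.

(** Reduction to lowest terms only shrinks a fraction: by coprimality in the cross-multiplied
    identity, [numq q] divides [n] and [denq q] divides [d]. For [d = 0] the quotient is 0, of
    minimal length. *)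
Lemma qsize_div (n d : int) :
  (qsize (n%:~R / d%:~R) <= 1 + bitlen `|n| + bitlen `|d|)%N.
Proof.
have [->|d0] := eqVneq d 0.
  by rewrite invr0 mulr0 /qsize /bitlen /= /trunc_log /=; lia.
set q := _ / _.
have qE : numq q * d = n * denq q.
  apply: (@intr_inj rat); rewrite !intrM numqE mulrAC.
  by congr (_ * _); rewrite divfK // intr_eq0.
have qE' : (`|numq q| * `|d| = `|n| * `|denq q|)%N by rewrite -!abszM qE.
have cop := coprime_num_den q.
have dvd_n : (`|numq q| %| `|n|)%N.
  by rewrite -(Gauss_dvdl _ cop) -qE' dvdn_mulr.
have dvd_d : (`|denq q| %| `|d|)%N.
  have cop' : coprime `|denq q| `|numq q| by rewrite coprime_sym.
  by rewrite -(Gauss_dvdr _ cop') qE' dvdn_mull.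
rewrite /qsize -!addnA leq_add2l leq_add ?leq_bitlen //; last first.
  by rewrite dvdn_leq // absz_gt0.
have [n0|n0] := eqVneq n 0; first by rewrite /q n0 mul0r.
by rewrite dvdn_leq // absz_gt0.
Qed.

Lemma qsizeM p q : (qsize (p * q) <= qsize p + qsize q)%N.
Proof.
rewrite -{1}(divq_num_den p) -{1}(divq_num_den q) mulf_div -!intrM.
apply: leq_trans (qsize_div _ _) _; rewrite !abszM /qsize.
have := bitlenM `|numq p| `|numq q|; have := bitlenM `|denq p| `|denq q|; lia.
Qed.

Lemma qsizeV q : (qsize q^-1 <= qsize q)%N.
Proof.
rewrite -{1}(divq_num_den q) invf_div.
by apply: leq_trans (qsize_div _ _) _; rewrite addnAC.
Qed.

Lemma qsizeX2 n : qsize (2 ^+ n) = n.+3.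
Proof.
have -> : (2 : rat) ^+ n = ((2 ^ n)%N : int)%:~R by rewrite -natrX.
by rewrite /qsize numq_int denq_int absz_nat bitlenX (bitlenX 0) addn1.
Qed.

Lemma dsize_gt0 v : (0 < dsize v)%N.
Proof. by case: v => [q|u w]; rewrite /= ?addnA. Qed.

Lemma qsize1D2X e : (qsize (1 + 2 * 2 ^- e) <= 2 * e + 6)%N.
Proof.
have -> : 1 + 2 * 2 ^- e = (2 ^ e + 2)%N%:Z%:~R / (2 ^ e)%N%:Z%:~R :> rat.
  by rewrite -!pmulrn natrD natrX [RHS]mulrDl divff // expf_neq0.
apply: leq_trans (qsize_div _ _) _; rewrite !absz_nat bitlenX.
have : (bitlen (2 ^ e + 2) <= bitlen (2 ^ e.+2))%N.
  by apply: leq_bitlen; rewrite !expnS; have := expn_gt0 2 e; lia.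
rewrite bitlenX; lia.
Qed.

(** * Straight-line programs run in linear time *)

(** Carries a bound proved for one run over to every run, as [T_ALG] and the final time bound
    require. *)
Lemma run_det p v w t w' t' : run p v w t -> run p v w' t' -> w = w' /\ t = t'.
Proof.
move=> H; move: w' t'; induction H => w' t' H'; inversion H'; subst => //.
all: repeat match goal with
  | IH : forall w' t', run ?p ?v w' t' -> _, H : run ?p ?v _ _ |- _ =>
    destruct (IH _ _ H); clear IH; subst
  end => //.
all: by exfalso; match goal with
  | H : is_true (truthy ?b), H' : is_true (~~ truthy ?b) |- _ =>
    rewrite H in H'
  end.
Qed.

Lemma run_size p v w t : run p v w t -> (dsize v <= t)%N /\ (dsize w <= t)%N.
Proof. by elim=> {p v w t} *; rewrite /=; lia. Qed.

(** Loops are excluded, and so are the primitives for which [dsize_prim] gives no size bound. *)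
Fixpoint straight (p : prog) : bool :=
  match p with
  | Prim o => match o with PAdd | PSub | PFloor => false | _ => true end
  | Seq p q | Fork p q => straight p && straight q
  | If c p q => [&& straight c, straight p & straight q]
  | While _ _ => false
  end.

(** Replaces derivations of [run] by computation; the value on [While] is a placeholder. *)
Fixpoint evalp (p : prog) (v : data) : data :=
  match p with
  | Prim o => eval_prim o v
  | Seq p q => evalp q (evalp p v)
  | Fork p q => Node (evalp p v) (evalp q v)
  | If c p q => if truthy (evalp c v) then evalp p v else evalp q v
  | While _ _ => v
  end.

Definition lintime (K : nat) (p : prog) : Prop :=
  forall v, exists2 t, run p v (evalp p v) t & (t <= K * dsize v)%N.

Lemma dsize_prim o : straight (Prim o) ->
  exists K, forall v, (dsize (eval_prim o v) <= K * dsize v)%N.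
Proof.
have szb (b : bool) : qsize b%:R = 3 by case: b.
have sz0 : qsize 0 = 3 by [].
have sz1 : qsize 1 = 3 by [].
case: o => [|q|||||||||] //= _; first by exists 1%N => v; rewrite mul1n.
  exists (qsize q) => v; rewrite leq_pmulr ?dsize_gt0 //.
all: exists 3%N => -[a|[a|a1 a2] [b|b1 b2]].
all: rewrite /= ?szb ?sz0 ?sz1 //.
all: try by have := qsizeM a b; have := qsizeM a b^-1; have := qsizeV b; lia.
all: try by have := qsize_gt2 a; lia.
all: try lia.
Qed.

(** Induction on [p]. In a sequence the intermediate value is no longer than the time that produced
    it, so the two constants multiply. *)
Lemma straight_lintime p : straight p -> exists K, lintime K p.
Proof.
elim: p => [ o|p IHp q IHq|p IHp q IHq|c IHc p IHp q IHq|//].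
- move=> /dsize_prim[K HK]; exists (2 + K)%N => v.
  exists (1 + dsize v + dsize (eval_prim o v))%N; first exact: RunPrim.
  by have := HK v; have := dsize_gt0 v; rewrite mulnDl; lia.
- move=> /= /andP[/IHp[K1 H1] /IHq[K2 H2]]; exists (1 + K1 + K2 * K1)%N => v.
  have [s Hs les] := H1 v; have [t Ht let_] := H2 (evalp p v).
  exists (1 + s + t)%N; first exact: RunSeq Hs Ht.
  have [_ szu] := run_size Hs; have := dsize_gt0 v.
  have : (K2 * dsize (evalp p v) <= K2 * (K1 * dsize v))%N.
    by rewrite leq_mul2l (leq_trans szu les) orbT.
  by rewrite !mulnDl -mulnA; lia.
- move=> /= /andP[/IHp[K1 H1] /IHq[K2 H2]]; exists (1 + K1 + K2)%N => v.
  have [s Hs les] := H1 v; have [t Ht let_] := H2 v.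
  exists (1 + s + t)%N; first exact: RunFork Hs Ht.
  by have := dsize_gt0 v; rewrite !mulnDl; lia.
- move=> /= /and3P[/IHc[K0 H0] /IHp[K1 H1] /IHq[K2 H2]].
  exists (1 + K0 + K1 + K2)%N => v /=.
  have [r Hr ler] := H0 v; have [s Hs les] := H1 v; have [t Ht let_] := H2 v.
  have := dsize_gt0 v; case: ifPn => b v0.
    by exists (1 + r + s)%N; [exact: RunIfTrue Hr b Hs | rewrite !mulnDl; lia].
  by exists (1 + r + t)%N; [exact: RunIfFalse Hr b Ht | rewrite !mulnDl; lia].
Qed.

(** * Composition of upper bounds on running times *)

Definition runs (p : prog) (v w : data) (c : nat) : Prop :=
  exists2 t, run p v w t & (t <= c)%N.

Lemma runsW p v w c c' : runs p v w c -> (c <= c')%N -> runs p v w c'.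
Proof. by case=> t Ht tc cc'; exists t => //; exact: leq_trans cc'. Qed.

Lemma runs_size p v w c : runs p v w c -> (dsize w <= c)%N.
Proof. by case=> t /run_size[_ le_wt]; exact: leq_trans. Qed.

(** Typically [c] is the cost of the program that produced [v], which bounds [dsize v] by
    [runs_size]. *)
Lemma runs_straight K p v w c : lintime K p -> w = evalp p v -> (dsize v <= c)%N ->
  runs p v w (K * c).
Proof.
move=> Kp -> vc; have [t Ht tK] := Kp v; exists t => //.
by rewrite (leq_trans tK) // leq_mul2l vc orbT.
Qed.

Lemma runs_seq p q v u w a b : runs p v u a -> runs q u w b ->
  runs (Seq p q) v w (1 + a + b).
Proof.
move=> [s Hs sa] [t Ht tb]; exists (1 + s + t)%N; first exact: RunSeq Hs Ht.
by rewrite !leq_add.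
Qed.

Definition call (sel q : prog) : prog := Fork (Prim PId) (Seq sel q).

Lemma runs_call K sel q v w c m : lintime K sel -> (dsize v <= c)%N ->
  runs q (evalp sel v) w m -> runs (call sel q) v (Node v w) ((K + 5) * c + m).
Proof.
move=> Ks vc [t Ht tm]; have [s Hs sK] := Ks v.
exists (1 + (1 + dsize v + dsize v) + (1 + s + t))%N.
  by apply: RunFork; [exact: (RunPrim PId)|exact: RunSeq Hs Ht].
have := dsize_gt0 v; have : (K * dsize v <= K * c)%N by rewrite leq_mul2l vc orbT.
by rewrite mulnDl; lia.
Qed.

(** * Search on the weights *)

Local Notation "p ;; q" := (Seq p q) (at level 60, right associativity).

Definition car : prog := Prim PFst.
Definition cdr : prog := Prim PSnd.
Definition binop (o : prim) (p q : prog) : prog := Fork p q ;; Prim o.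

(** The largest number is on top, so the search tries its largest step first; the bottom [Atom 0] is
    what stops [search_cond]. *)
Fixpoint tower (n : nat) : data :=
  if n is m.+1 then Node (Atom (2 ^+ (2 ^ m))) (tower m) else Atom 0.

(** Entry lengths roughly double from one level to the next, so the whole stack is only a constant
    factor longer than its top entry. *)
Lemma dsize_tower n : (dsize (tower n) <= 6 * 2 ^ n)%N.
Proof.
elim: n => [|n IHn]; first by [].
rewrite [dsize _]/= -/dsize -/(qsize _) qsizeX2 expnS.
by have := expn_gt0 2 n; lia.
Qed.

Lemma leq_dsize_tower m n : (m <= n)%N -> (dsize (tower m) <= dsize (tower n))%N.
Proof.
elim: n => [|n IHn]; first by rewrite leqn0 => /eqP->.
by rewrite leq_eqVlt => /predU1P[->//|/IHn le_mn]; rewrite /=; lia.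
Qed.

(** Data layout: [((input, relaxed budget), weight), (UB(2) / LB(2), tower i)]. *)
Definition grow_cond : prog := binop PLeq (cdr ;; cdr ;; car) (cdr ;; car).
Definition grow_body : prog :=
  Fork car (Fork (cdr ;; car)
    (Fork (binop PMul (cdr ;; cdr ;; car) (cdr ;; cdr ;; car)) (cdr ;; cdr))).

(** There are [k] squarings and one failed test, each linear in the state; the stack only grows, so
    the size of the final state bounds them all. *)
Lemma grow_runs : exists K, forall env r k c,
  r < 2 ^+ (2 ^ k) -> (forall i, (i < k)%N -> 2 ^+ (2 ^ i) <= r) ->
  (dsize (Node env (Node (Atom r) (tower k.+1))) <= c)%N ->
  runs (While grow_cond grow_body) (Node env (Node (Atom r) (tower 1)))
       (Node env (Node (Atom r) (tower k.+1))) (K * k.+1 * c).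
Proof.
have [K1 HK1] : exists K, lintime K grow_cond by exact: straight_lintime.
have [K2 HK2] : exists K, lintime K grow_body by exact: straight_lintime.
exists (1 + K1 + K2)%N => env r k c rk rlt szc.
(* Induction on the number [i] of squarings still to be done, since the final state is the fixed
   end. *)
suff main i : (i <= k)%N -> runs (While grow_cond grow_body)
    (Node env (Node (Atom r) (tower (k - i).+1)))
    (Node env (Node (Atom r) (tower k.+1))) ((1 + K1 + K2) * i.+1 * c).
  by have := main k (leqnn k); rewrite subnn.
have sz j : (j <= k)%N ->
    (dsize (Node env (Node (Atom r) (tower j.+1))) <= c)%N.
  move=> jk; apply: leq_trans szc; rewrite [dsize _]/= [leqRHS]/= -/dsize.
  by have := @leq_dsize_tower j.+1 k.+1 jk; rewrite /=; lia.
have c_gt0 : (0 < c)%N by apply: leq_trans szc; exact: dsize_gt0.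
elim: i => [_|i IHi ik].
  rewrite subn0.
  have [t Ht tK] := runs_straight HK1 erefl szc.
  exists (1 + t)%N; last by rewrite muln1 !mulnDl; lia.
  by apply: RunWhileFalse Ht _; rewrite /= leNgt rk.
have [t Ht tK] := runs_straight HK1 erefl (sz (k - i.+1)%N (leq_subr _ _)).
have [s Hs sK] := runs_straight HK2 erefl (sz (k - i.+1)%N (leq_subr _ _)).
have [w Hw wK] := IHi (ltnW ik).
exists (1 + t + s + w)%N; last first.
  rewrite mulnS [leqRHS]mulnDl; apply: leq_trans (leq_add (leqnn _) wK).
  by rewrite leq_add2r !mulnDl; lia.
apply: RunWhileTrue Ht _ Hs _.
  by rewrite /= rlt // ; lia.
have -> : evalp grow_body (Node env (Node (Atom r) (tower (k - i.+1).+1))) =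
    Node env (Node (Atom r) (tower (k - i).+1)).
  by rewrite -(subnSK ik) /= -exprD addnn -mul2n -expnS.
exact: Hw.
Qed.

(** The loop state [s] is [(input, relaxed budget), ((weight, answer), tower i)];
    [update] receives [((s, weight'), answer'), value']. *)
Definition update : prog :=
  If (binop PLeq cdr (car ;; car ;; car ;; car ;; cdr))
    (Fork (car ;; car ;; car ;; car)
      (Fork (Fork (car ;; car ;; cdr) (car ;; cdr))
            (car ;; car ;; car ;; cdr ;; cdr ;; cdr)))
    (Fork (car ;; car ;; car ;; car)
      (Fork (car ;; car ;; car ;; cdr ;; car)
            (car ;; car ;; car ;; cdr ;; cdr ;; cdr))).
Definition next_weight : prog :=
  Fork (Prim PId) (binop PMul (cdr ;; car ;; car) (cdr ;; cdr ;; car)).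
Definition ws_arg : prog := Fork (car ;; car ;; car) cdr.
(** Objective programs take the bare instance, so the bounds and the [Atom 0] tag of the answer are
    stripped. *)
Definition obj_arg : prog := Fork (car ;; car ;; car ;; car ;; car) (cdr ;; cdr).
Definition search_cond : prog := cdr ;; cdr ;; Prim PIsNode.
Definition search_body (alg objp : prog) : prog :=
  next_weight ;; call ws_arg alg ;; call obj_arg objp ;; update.

(** Outside the two calls everything is straight-line, on values no longer than the costs
    accumulated so far; [c1] to [c4] are these costs in units of [c]. *)
Lemma search_body_runs : exists K, forall alg objp I bd Bb g a D st x f c,
  let s := Node (Node (Node I bd) (Atom Bb))
                (Node (Node (Atom g) a) (Node (Atom D) st)) in
  (dsize s <= c)%N ->
  runs alg (Node (Node I bd) (Atom (g * D))) (answer (Some x)) c ->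
  runs objp (Node I x) (Atom f) c ->
  runs (search_body alg objp) s
    (Node (Node (Node I bd) (Atom Bb))
      (Node (if f <= Bb then Node (Atom (g * D)) (answer (Some x))
             else Node (Atom g) a) st)) (K * c).
Proof.
have [K1 HK1] : exists K, lintime K next_weight by exact: straight_lintime.
have [K2 HK2] : exists K, lintime K ws_arg by exact: straight_lintime.
have [K3 HK3] : exists K, lintime K obj_arg by exact: straight_lintime.
have [K4 HK4] : exists K, lintime K update by exact: straight_lintime.
pose c1 := K1; pose c2 := ((K2 + 5) * c1 + 1)%N; pose c3 := ((K3 + 5) * c2 + 1)%N.
pose c4 := (K4 * c3)%N.
exists (3 + c1 + c2 + c3 + c4)%N => alg objp I bd Bb g a D st x f c s sc Halg Hobj.
have c_gt0 : (0 < c)%N by apply: leq_trans sc; exact: dsize_gt0.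
have R1 : runs next_weight s (Node s (Atom (g * D))) (c1 * c).
  by apply: runs_straight HK1 _ sc.
have R2 : runs (call ws_arg alg) (Node s (Atom (g * D)))
    (Node (Node s (Atom (g * D))) (answer (Some x))) (c2 * c).
  apply: runsW (runs_call HK2 (runs_size R1) Halg) _.
  by rewrite /c2 [leqRHS]mulnDl mul1n mulnA.
have R3 : runs (call obj_arg objp) (Node (Node s (Atom (g * D))) (answer (Some x)))
    (Node (Node (Node s (Atom (g * D))) (answer (Some x))) (Atom f)) (c3 * c).
  apply: runsW (runs_call HK3 (runs_size R2) Hobj) _.
  by rewrite /c3 [leqRHS]mulnDl mul1n mulnA.
have R4 := runs_straight HK4 erefl (runs_size R3).
have := runs_seq R1 (runs_seq R2 (runs_seq R3 R4)).
rewrite [evalp update _]/=.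
move=> R; case: (f <= Bb)%R R => /= R; apply: runsW R _; rewrite mulnA -/c4 !mulnDl; lia.
Qed.
(** * Correctness of the search *)

Definition under_budget (Pi : biproblem) (I : data) (B : rat) (y : data) : Prop :=
  feasible Pi I y /\ obj Pi crit1 I y <= B.

Definition weight (Pi : biproblem) (I : data) (B : rat) (e j : nat) : rat :=
  2 ^- e * B / UB Pi I crit2 * 2 ^+ j.

Definition relaxed (B : rat) (e : nat) : rat := (1 + 2 * 2 ^- e) * B.

(** If the weight with exponent [j + 2 ^ i] fails the test, its product with [f2 y]
    exceeds [2 * 2 ^- e * B] for all [y] within budget, which is the last clause: it
    bounds the exponents still to be tried from above. *)
Definition search_inv (Pi : biproblem) (I : data) (B : rat) (e i j : nat) (x : data)
    : Prop :=
  [/\ ws_correct Pi I (weight Pi I B e j) (Some x),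
      forall y, under_budget Pi I B y -> obj Pi crit1 I x <= relaxed B e
    & forall y, under_budget Pi I B y ->
        2 * UB Pi I crit2 < 2 ^+ (j + 2 ^ i) * obj Pi crit2 I y].

Lemma weight_gt0 Pi I B e j : instance Pi I -> 0 < B -> 0 < weight Pi I B e j.
Proof.
by move=> HI B0; rewrite /weight !mulr_gt0 ?invr_gt0 ?exprn_gt0 ?UB_gt0.
Qed.

Lemma weightD Pi I B e j n :
  weight Pi I B e j * 2 ^+ n = weight Pi I B e (j + n).
Proof. by rewrite /weight exprD mulrA. Qed.

(** At exponent 0 the weighted second objective of [y] is at most [2 ^- e * B], so
    [f1 x <= (1 + 2 ^- e) * B]. For the upper end, [2 ^+ (2 ^ k.+1)] is the square of
    [2 ^+ (2 ^ k)]: one factor exceeds [UB / LB], the other is at least 2. *)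
Lemma search_inv_init Pi I B e k x : instance Pi I -> 0 < B ->
  UB Pi I crit2 / LB Pi I crit2 < 2 ^+ (2 ^ k) ->
  ws_correct Pi I (weight Pi I B e 0) (Some x) ->
  search_inv Pi I B e k.+1 0 x.
Proof.
move=> HI B0; rewrite ltr_pdivrMr ?LB_gt0 // => Uk Hx; split => // y [Fy yB].
- case: Hx => Fx /(_ y Fy); rewrite /weighted_sum /relaxed.
  have fx0 := obj_gt0 crit2 HI Fx.
  have /andP[_ yU] := obj_bounds crit2 HI Fy.
  have w0 := weight_gt0 e 0 HI B0.
  have : weight Pi I B e 0 * obj Pi crit2 I y <= 2 ^- e * B.
    rewrite /weight expr0 mulr1 mulrAC -mulrA ger_pMr ?mulr_gt0 ?invr_gt0 ?exprn_gt0 //.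
    by rewrite mulrC ler_pdivrMl ?UB_gt0 // mulr1.
  have : 0 < weight Pi I B e 0 * obj Pi crit2 I x by rewrite mulr_gt0.
  have : 0 < 2 ^- e * B by rewrite mulr_gt0 ?invr_gt0 ?exprn_gt0.
  by lra.
- have /andP[Ly _] := obj_bounds crit2 HI Fy.
  rewrite add0n expnS mul2n -addnn exprD -mulrA.
  have A2 : 2 <= 2 ^+ (2 ^ k) :> rat.
    by rewrite -[leLHS]expr1 ler_eXn2l ?expn_gt0 //; lra.
  have y0 := obj_gt0 crit2 HI Fy; have U0 := UB_gt0 crit2 HI.
  apply: le_lt_trans (_ : _ <= 2 ^+ (2 ^ k) * UB Pi I crit2) _.
    by rewrite ler_wpM2r // ltW.
  rewrite ltr_pM2l ?(lt_le_trans _ A2) //.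
  by apply: lt_le_trans Uk _; rewrite ler_wpM2l ?(le_trans _ A2).
Qed.

(** On success the upper end [j + 2 ^ i.+1] does not move. On failure, minimality of [x'] against
    [y] leaves more than [2 * 2 ^- e * B] for the weighted second objective of [y], which lowers the
    upper end to [j + 2 ^ i]. *)
Lemma search_inv_step Pi I B e i j x x' : instance Pi I -> 0 < B ->
  search_inv Pi I B e i.+1 j x ->
  ws_correct Pi I (weight Pi I B e (j + 2 ^ i)) (Some x') ->
  if obj Pi crit1 I x' <= relaxed B e then search_inv Pi I B e i (j + 2 ^ i) x'
  else search_inv Pi I B e i j x.
Proof.
move=> HI B0 [Hx xB xU] Hx'; case: ifPn => [x'B|].
  by split=> // y /xU; rewrite -addnA addnn -mul2n -expnS.
rewrite -ltNge => x'B; split => // y [Fy yB].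
case: Hx' => Fx' /(_ y Fy); rewrite /weighted_sum => le_y.
have w0 := weight_gt0 e (j + 2 ^ i) HI B0.
have : 0 < weight Pi I B e (j + 2 ^ i) * obj Pi crit2 I x'.
  by rewrite mulr_gt0 // obj_gt0.
move=> wx'; have : 2 * (2 ^- e * B) < weight Pi I B e (j + 2 ^ i) * obj Pi crit2 I y.
  by move: x'B; rewrite /relaxed; lra.
have eB : 0 < 2 ^- e * B by rewrite mulr_gt0 ?invr_gt0 ?exprn_gt0.
rewrite /weight -!mulrA [in ltRHS]mulrA [ltLHS]mulrC ltr_pM2l //.
by rewrite ltr_pdivlMl ?UB_gt0 // mulrC.
Qed.

(** Once the interval has length 1, the upper end gives [B <= 2 ^+ e * (w * f2 y)] for the current
    weight [w]; minimality gives [w * f2 x <= B + w * f2 y]. *)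
Lemma search_inv_opt Pi I B e j x y : instance Pi I -> 0 < B ->
  search_inv Pi I B e 0 j x -> under_budget Pi I B y ->
  obj Pi crit2 I x <= (1 + 2 ^+ e) * obj Pi crit2 I y.
Proof.
move=> HI B0 [[Fx Hx] _ xU] Uy; have := xU y Uy; case: Uy => Fy yB.
have w0 := weight_gt0 e j HI B0; have U0 := UB_gt0 crit2 HI.
rewrite addn1 exprS -mulrA ltr_pM2l // => UT.
have Bw : B <= 2 ^+ e * (weight Pi I B e j * obj Pi crit2 I y).
  rewrite /weight !mulrA mulfV ?expf_neq0 // mul1r -!mulrA ler_peMr ?(ltW B0) //.
  by rewrite ler_pdivlMl // mulr1 ltW.
have := Hx y Fy; rewrite /weighted_sum => le_y.
have fx0 := obj_gt0 crit1 HI Fx.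
rewrite -(ler_pM2l w0) mulrCA mulrDl mul1r; lra.
Qed.

Definition search (alg objp : prog) : prog := While search_cond (search_body alg objp).

Definition search_state (Pi : biproblem) (I : data) (B : rat) (e i j : nat) (x : data)
    : data :=
  Node (Node (instance_input Pi I) (Atom (relaxed B e)))
       (Node (Node (Atom (weight Pi I B e j)) (answer (Some x))) (tower i)).

(** [J] caps the exponents that can be reached, hence the lengths of the weights passed to [alg];
    [j + 2 ^ i <= J.+1] is preserved by either outcome of the test. *)
Lemma search_runs : exists K, forall Pi alg I B e J c,
  instance Pi I -> 0 < B ->
  (forall j, (j <= J)%N -> exists o,
     [/\ runs alg (param_input Pi I (weight Pi I B e j)) (answer o) c,
         ws_correct Pi I (weight Pi I B e j) o
       & forall x, o = Some x ->
         runs (obj_prog Pi crit1) (Node I x) (Atom (obj Pi crit1 I x)) c]) ->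
  (forall i j x, (j <= J)%N -> (2 ^ i <= J.+1)%N -> (dsize (answer (Some x)) <= c)%N ->
     (dsize (search_state Pi I B e i j x) <= 4 * c)%N) ->
  forall i j x, (j + 2 ^ i <= J.+1)%N -> (dsize (answer (Some x)) <= c)%N ->
  search_inv Pi I B e i j x ->
  exists j' x', runs (search alg (obj_prog Pi crit1)) (search_state Pi I B e i j x)
    (search_state Pi I B e 0 j' x') (K * i.+1 * c) /\ search_inv Pi I B e 0 j' x'.
Proof.
have [K1 HK1] : exists K, lintime K search_cond by exact: straight_lintime.
have [K2 HK2] := search_body_runs.
exists (1 + (K1 * 4) + (K2 * 4))%N => Pi alg I B e J c HI B0 Halg Hsz.
elim=> [|i IHi] j x jJ xc Hinv.
  exists j, x; split => //.
  have sz := Hsz 0%N j x; rewrite addn1 ltnS in jJ.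
  have [t Ht tK] := runs_straight HK1 erefl (sz jJ isT xc).
  exists (1 + t)%N; first by apply: RunWhileFalse Ht _.
  have : (0 < c)%N by rewrite (leq_trans _ xc) // dsize_gt0.
  by rewrite muln1 !mulnDl -mulnA; lia.
have i0 : (0 < 2 ^ i)%N by rewrite expn_gt0.
move: (jJ); rewrite expnS => jJ'.
have jJi : (j + 2 ^ i <= J)%N by lia.
have [ o [Ho oc objc]] := Halg _ jJi.
(* The answer infeasible is impossible: the invariant carries a feasible [x]. *)
case: o Ho oc objc => [x'|] Hx' x'c objc; last first.
  case: Hinv => -[Fx _] _ _; move: x'c => /= E.
  by rewrite E in Fx.
have sz := Hsz i.+1 j x.
have jJ2 : (j <= J)%N by lia.
have iJ2 : (2 ^ i.+1 <= J.+1)%N by lia.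
have {}sz := sz jJ2 iJ2 xc.
have := HK2 alg (obj_prog Pi crit1) I _ (relaxed B e) _ _ _ _ x' _ _ sz.
rewrite weightD.
move=> /(_ (obj Pi crit1 I x') (runsW Hx' _) (runsW (objc _ erefl) _)).
have c4 : (c <= 4 * c)%N by lia.
move=> /(_ c4 c4) Hbody.
have [t Ht tK] := runs_straight HK1 erefl sz.
have [s Hs sK] := Hbody.
have x'sz := runs_size Hx'.
have [j1 [x1 [j1J x1c inv1 stE]]] : exists j1 x1, [/\ (j1 + 2 ^ i <= J.+1)%N,
    (dsize (answer (Some x1)) <= c)%N, search_inv Pi I B e i j1 x1
  & run (search_body alg (obj_prog Pi crit1)) (search_state Pi I B e i.+1 j x)
     (search_state Pi I B e i j1 x1) s].
  have := search_inv_step HI B0 Hinv x'c.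
  move: Hs; case: ifP => _ Hs inv1.
    by exists (j + 2 ^ i)%N, x'; split => //; lia.
  by exists j, x; split => //; lia.
have [j' [x2 [[w Hw wK] inv']]] := IHi _ _ j1J x1c inv1.
exists j', x2; split => //; exists (1 + t + s + w)%N.
  by apply: RunWhileTrue Ht _ stE Hw.
have c0 : (0 < c)%N by rewrite (leq_trans _ xc) // dsize_gt0.
rewrite mulnS [leqRHS]mulnDl; apply: leq_trans (leq_add (leqnn _) wK).
by rewrite leq_add2r !mulnDl -!mulnA; lia.
Qed.
(** * The approximation algorithm *)

Lemma dsize_param_input Pi I B : dsize (param_input Pi I B) =
  (1 + (1 + dsize I +
        (1 + (1 + qsize (LB Pi I crit1) + qsize (UB Pi I crit1)) +
             (1 + qsize (LB Pi I crit2) + qsize (UB Pi I crit2)))) + qsize B)%N.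
Proof. by []. Qed.

Lemma runs_if c p q v b w m n : runs c v b m ->
  runs (if truthy b then p else q) v w n -> runs (If c p q) v w (1 + m + n).
Proof.
move=> [s Hs sm]; case: ifPn => tb [t Ht tn]; exists (1 + s + t)%N.
- exact: RunIfTrue Hs tb Ht.
- by rewrite !leq_add.
- exact: RunIfFalse Hs tb Ht.
- by rewrite !leq_add.
Qed.

(** Take the least [k] with [r < 2 ^+ (2 ^ k)]. If [k > 0], then [2 ^+ (2 ^ k.-1)] is at most [r],
    hence at most the numerator of [r], whose bit length therefore bounds [2 ^ k.-1]. *)
Lemma tower_height (r : rat) : exists k,
  [/\ r < 2 ^+ (2 ^ k), forall i, (i < k)%N -> 2 ^+ (2 ^ i) <= r
    & (2 ^ k <= 2 * qsize r)%N].
Proof.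
have le_num : r <= `|numq r|%N%:R.
  have den1 : (1 : rat) <= (denq r)%:~R by rewrite ler1z -gtz0_ge1 denq_gt0.
  rewrite natr_absz intr_norm numqE normrM (ger0_norm (_ : 0 <= (denq r)%:~R)).
    by rewrite (le_trans (ler_norm r)) // ler_peMr.
  by rewrite (le_trans _ den1).
have ex : exists k, r < 2 ^+ (2 ^ k).
  exists `|numq r|%N; apply: le_lt_trans le_num _; rewrite -natrX ltr_nat.
  exact: ltn_trans (ltn_expl _ (ltnSn 1)) (ltn_expl _ (ltnSn 1)).
case: (ex_minnP ex) => k rk kmin; exists k; split => // [i ik|].
  by rewrite leNgt; apply: contraL ik => /kmin; rewrite -leqNgt.
case: k rk kmin => [|k] _ kmin; first by have := qsize_gt2 r; lia.
have kr : 2 ^+ (2 ^ k) <= r by rewrite leNgt; apply/negP => /kmin; rewrite ltnn.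
have := le_trans kr le_num; rewrite -natrX ler_nat => /(trunc_log_max (ltnSn 1)).
by rewrite expnS /qsize /bitlen; lia.
Qed.

(** All constants depending on [e] are isolated here. The cost of this part is computed by hand,
    since the constant from [straight_lintime] would depend on [e]. *)
Definition prologue (e : nat) : prog :=
  Fork (Prim PId) (Fork (Prim (PConst (2 ^- e))) (Prim (PConst (1 + 2 * 2 ^- e)))).
Definition ub2 : prog := car ;; car ;; cdr ;; cdr ;; cdr.
Definition lb2 : prog := car ;; car ;; cdr ;; cdr ;; car.
(** Builds the first state of the growing loop; its last component is [tower 1]. *)
Definition start : prog :=
  Fork (Fork (Fork (car ;; car) (binop PMul (cdr ;; cdr) (car ;; cdr)))
             (binop PDiv (binop PMul (cdr ;; car) (car ;; cdr)) ub2))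
       (Fork (binop PDiv ub2 lb2) (Fork (Prim (PConst 2)) (Prim (PConst 0)))).
Definition first_arg : prog := Fork (car ;; car ;; car) (car ;; cdr).
Definition init : prog :=
  Fork (car ;; car ;; car) (Fork (Fork (car ;; car ;; cdr) cdr) (car ;; cdr ;; cdr)).
Definition result : prog := cdr ;; car ;; cdr.
(** The condition [cdr] reads the first answer: [Atom 0], for infeasible, is not truthy and is
    returned as it stands. *)
Definition budget_prog (alg objp : prog) (e : nat) : prog :=
  prologue e ;; start ;; While grow_cond grow_body ;; call first_arg alg ;;
  If cdr (init ;; search alg objp ;; result) cdr.

(** Comparing with every [y] within budget, instead of the infimum, keeps the guarantee over the
    rationals. *)
Definition grid_correct (Pi : biproblem) (I : data) (B : rat) (e : nat)
    (o : option data) : Prop :=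
  match o with
  | Some x => feasible Pi I x /\ forall y, under_budget Pi I B y ->
      obj Pi crit1 I x <= relaxed B e /\
      obj Pi crit2 I x <= (1 + 2 ^+ e) * obj Pi crit2 I y
  | None => feasible Pi I = set0
  end.

(** [N] is left abstract to serve twice: as a polynomial bound for polynomial time, and as [T_ALG]
    plus [T_obj] for the precise running time. [K] is uniform in [e]. *)
Lemma budget_prog_runs : exists K, forall Pi alg I B e N,
  instance Pi I -> 0 < B -> (dsize (param_input Pi I B) + e <= N)%N ->
  (forall gamma, 0 < gamma ->
     (qsize gamma <= K * (dsize (param_input Pi I B) + e))%N -> exists o,
     [/\ runs alg (param_input Pi I gamma) (answer o) N,
         ws_correct Pi I gamma o
       & forall x, o = Some x ->
         runs (obj_prog Pi crit1) (Node I x) (Atom (obj Pi crit1 I x)) N]) ->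
  exists o k,
    [/\ runs (budget_prog alg (obj_prog Pi crit1) e) (param_input Pi I B) (answer o)
          (K * (k.+1 * N)),
        (k < 2 * dsize (param_input Pi I B))%N,
        forall i, (i < k)%N -> 2 ^+ (2 ^ i) <= UB Pi I crit2 / LB Pi I crit2
      & grid_correct Pi I B e o].
Proof.
have [K1 HK1] : exists K, lintime K start by exact: straight_lintime.
have [K2 HK2] := grow_runs.
have [K3 HK3] : exists K, lintime K first_arg by exact: straight_lintime.
have [K4 HK4] : exists K, lintime K init by exact: straight_lintime.
have [K5 HK5] := search_runs.
have [K6 HK6] : exists K, lintime K result by exact: straight_lintime.
have [K7 HK7] : exists K, lintime K cdr by exact: straight_lintime.
(* [c1 * (S + e)] bounds the cost of [start], [c2 * (S + e)] the state after growing, [c3 * N] the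
   first call, [c4 * (S + e)] the weights and [c5 * X] the search. *)
pose c1 := (K1 * 12)%N; pose c2 := (25 * c1)%N; pose c3 := ((K3 + 5) * c2 + 1)%N.
pose c4 := (30 * c1 + 6)%N; pose c5 := (K5 * 2 * c4)%N.
exists (60 + c1 + K2 * c2 + c3 + K4 * c3 + c5 + K6 * c5 + 2 * K7 * c3 + c4)%N.
move=> Pi alg I B e N HI B0 leN Halg.
set S := dsize (param_input Pi I B) in leN Halg.
have S0 : (0 < S)%N by exact: dsize_gt0.
set r := UB Pi I crit2 / LB Pi I crit2.
have [k [rk krl kr]] := tower_height r.
set inp := instance_input Pi I.
pose env := Node (Node inp (Atom (relaxed B e))) (Atom (weight Pi I B e 0)).
pose X := (k.+1 * N)%N.
have NX : (N <= X)%N by rewrite /X mulSn leq_addr.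
pose v1 := Node (param_input Pi I B) (Node (Atom (2 ^- e)) (Atom (1 + 2 * 2 ^- e))).
have qe : (qsize (2 ^- e) <= e + 3)%N.
  by apply: leq_trans (qsizeV _) _; rewrite qsizeX2 addn3.
have qe' := qsize1D2X e.
have v1sz : (dsize v1 <= 12 * (S + e))%N.
  have -> : dsize v1 = (1 + S + (1 + qsize (2 ^- e) + qsize (1 + 2 * 2 ^- e)))%N by [].
  by lia.
have R0 : runs (prologue e) (param_input Pi I B) v1 (50 * X).
  exists (1 + (1 + S + S) + (1 + (1 + S + qsize (2 ^- e)) +
                                 (1 + S + qsize (1 + 2 * 2 ^- e))))%N; last by lia.
  by apply: RunFork; [exact: (RunPrim PId)|apply: RunFork;
    [exact: (RunPrim (PConst _))|exact: (RunPrim (PConst _))]].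
have R1 : runs start v1 (Node env (Node (Atom r) (tower 1))) (c1 * (S + e)).
  rewrite /c1 -mulnA; apply: runs_straight HK1 _ v1sz.
  by rewrite /env /weight expr0 mulr1.
have s0sz := runs_size R1.
have szs0 : dsize (Node env (Node (Atom r) (tower 1))) = (dsize env + qsize r + 10)%N.
  have -> : dsize (Node env (Node (Atom r) (tower 1))) =
    (1 + dsize env + (1 + qsize r + 8))%N by [].
  by lia.
have szs1 : (dsize (Node env (Node (Atom r) (tower k.+1))) <= c2 * (S + e))%N.
  have := dsize_tower k.+1.
  have -> : dsize (Node env (Node (Atom r) (tower k.+1))) =
    (1 + dsize env + (1 + qsize r + dsize (tower k.+1)))%N by [].
  by rewrite expnS /c2 -mulnA; lia.
pose n := (S + e)%N; rewrite -/n in leN s0sz szs1 Halg.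
have N0 : (0 < N)%N by lia.
have scale a : (a * n <= a * N)%N by rewrite leq_mul2l leN orbT.
have scaleX a : (a * N <= a * X)%N by rewrite leq_mul2l NX orbT.
have R2 := HK2 env r k _ rk krl szs1.
have {}R2 : runs (While grow_cond grow_body) (Node env (Node (Atom r) (tower 1)))
    (Node env (Node (Atom r) (tower k.+1))) (K2 * c2 * X).
  apply: runsW R2 _; rewrite /X [leqRHS]mulnA.
  by rewrite (_ : K2 * k.+1 * (c2 * n) = K2 * c2 * k.+1 * n)%N ?scale //; ring.
set s1 := Node env (Node _ (tower k.+1)) in R2 szs1.
(* The factor [2 ^+ j] has length [j + 3], and [j < 2 ^ k.+1 <= 4 * qsize r]. *)
have qw j : (j < 2 ^ k.+1)%N ->
    (qsize (weight Pi I B e j) <= dsize env + 4 * qsize r + 3)%N.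
  move=> jk; rewrite -[j]add0n -weightD; apply: leq_trans (qsizeM _ _) _.
  rewrite qsizeX2; rewrite expnS in jk.
  have -> : dsize env =
    (1 + dsize (Node inp (Atom (relaxed B e))) + qsize (weight Pi I B e 0))%N by [].
  by lia.
have Hw j : (j < 2 ^ k.+1)%N -> exists o,
    [/\ runs alg (param_input Pi I (weight Pi I B e j)) (answer o) N,
        ws_correct Pi I (weight Pi I B e j) o
      & forall x, o = Some x ->
        runs (obj_prog Pi crit1) (Node I x) (Atom (obj Pi crit1 I x)) N].
  move=> /qw jk; apply: Halg; first exact: weight_gt0.
  apply: (@leq_trans (c4 * n)%N); last by rewrite leq_mul2r leq_addl orbT.
  by apply: leq_trans jk _; rewrite /c4 mulnDl -mulnA; lia.
have [ o [Ho oc objc]] := Hw 0%N (expn_gt0 2 k.+1).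
have R3 : runs (call first_arg alg) s1 (Node s1 (answer o)) (c3 * N).
  apply: runsW (runs_call HK3 szs1 Ho) _.
  by rewrite /c3 [leqRHS]mulnDl mul1n leq_add2r mulnA.
have s2sz := runs_size R3.
have RC := runs_straight HK7 erefl s2sz.
suff [ o' [RI corr]] : exists o', runs
    (if truthy (answer o) then init ;; search alg (obj_prog Pi crit1) ;; result
     else cdr) (Node s1 (answer o)) (answer o')
    ((2 + K4 * c3 + c5 + K6 * c5 + K7 * c3) * X) /\ grid_correct Pi I B e o'.
  exists o', k; split => //; last first.
    apply: (@leq_trans (2 ^ k)); first exact: ltn_expl.
    apply: leq_trans kr _; rewrite leq_mul2l; apply/orP; right.
    apply: leq_trans (qsizeM _ _) _; have := qsizeV (LB Pi I crit2).
    rewrite dsize_param_input; lia.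
  apply: runsW (runs_seq R0 (runs_seq (runsW R1 (scale _)) (runs_seq R2
    (runs_seq R3 (runs_if RC RI))))) _.
  have := scaleX c3; have := scaleX c1; have := scaleX (K7 * c3)%N.
  have : (0 < X)%N by exact: leq_trans NX.
  have : (6 * X <= c4 * X)%N by rewrite leq_mul2r leq_addl orbT.
  rewrite -/X; clear; clearbody X c1 c2 c3 c4 c5.
  by rewrite !mulnDl -!mulnA; lia.
case: o Ho oc objc RC R3 s2sz => [x|] Ho oc objc RC R3 s2sz; last first.
  exists None; split; last exact: oc.
  apply: runsW RC _; rewrite mulnA; apply: leq_trans (scaleX _) _.
  by rewrite leq_mul2r leq_addl orbT.
have R4 := runs_straight HK4 erefl s2sz.
have inv0 := search_inv_init HI B0 rk oc.
have k1 : (0 < 2 ^ k.+1)%N by rewrite expn_gt0.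
have Nc4 : (N <= c4 * N)%N by rewrite leq_pmull // /c4; lia.
(* [2 ^ k.+1 - 1] is the sum of all increments [2 ^ i] with [i <= k], hence the largest exponent the
   search can try. *)
have HA j : (j <= (2 ^ k.+1).-1)%N -> exists o,
    [/\ runs alg (param_input Pi I (weight Pi I B e j)) (answer o) (c4 * N),
        ws_correct Pi I (weight Pi I B e j) o
      & forall x, o = Some x ->
        runs (obj_prog Pi crit1) (Node I x) (Atom (obj Pi crit1 I x)) (c4 * N)].
  rewrite -ltnS prednK // => /Hw[ o1 [Ho1 o1c obj1]].
  by exists o1; split => [|//|y /obj1 Hy]; [apply: runsW Ho1 _|apply: runsW Hy _].
have HS i j y : (j <= (2 ^ k.+1).-1)%N -> (2 ^ i <= (2 ^ k.+1).-1.+1)%N ->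
    (dsize (answer (Some y)) <= c4 * N)%N ->
    (dsize (search_state Pi I B e i j y) <= 4 * (c4 * N))%N.
  rewrite -ltnS prednK // => /qw wj ik szy.
  have -> : dsize (search_state Pi I B e i j y) =
    (1 + dsize (Node inp (Atom (relaxed B e))) +
     (1 + (1 + qsize (weight Pi I B e j) + dsize (answer (Some y)))
      + dsize (tower i)))%N by [].
  have := dsize_tower i; rewrite expnS in ik.
  have c4n : (30 * (c1 * n) <= c4 * N)%N.
    by rewrite mulnA; apply: leq_trans (scale _) _; rewrite leq_mul2r leq_addr orbT.
  have env_sz : dsize env =
    (1 + dsize (Node inp (Atom (relaxed B e))) + qsize (weight Pi I B e 0))%N by [].
  by move: (c4 * N)%N c4n szy => c c4n szy; lia.
have szx : (dsize (answer (Some x)) <= c4 * N)%N by apply: leq_trans (runs_size Ho) _.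
have k0 : (0 + 2 ^ k.+1 <= (2 ^ k.+1).-1.+1)%N by rewrite add0n prednK.
have [j' [x' [R5 inv']]] := HK5 _ _ _ _ _ _ _ HI B0 HA HS k.+1 0%N x k0 szx inv0.
have {}R5 : runs (search alg (obj_prog Pi crit1)) (search_state Pi I B e k.+1 0 x)
    (search_state Pi I B e 0 j' x') (c5 * X).
  apply: runsW R5 _.
  (* The factor 2 in [c5] absorbs [k.+2 <= 2 * k.+1]. *)
  rewrite (_ : K5 * k.+2 * (c4 * N) = K5 * c4 * (k.+2 * N))%N; last by ring.
  rewrite (_ : c5 * X = K5 * c4 * (2 * X))%N; last by rewrite /c5; ring.
  by rewrite leq_mul2l /X mulnA leq_mul2r; apply/orP; right; apply/orP; right; lia.
have R6 := runs_straight HK6 erefl (runs_size R5).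
exists (Some x'); split.
  apply: runsW (runs_seq R4 (runs_seq R5 R6)) _.
  have := scaleX (K4 * c3)%N; have : (0 < X)%N by exact: leq_trans NX.
  by clear; clearbody X c1 c2 c3 c4 c5; rewrite !mulnDl -!mulnA; lia.
have [[Fx' _] x'B _] := inv'; split => // y yB; split; first exact: x'B yB.
exact: search_inv_opt inv' yB.
Qed.
(** * Running times *)

(** Polynomials known by their values, so that bounds are assembled from closure properties rather
    than coefficients. *)
Definition polyfun (f : nat -> nat) : Prop :=
  exists p : {poly nat}, forall n, p.[n] = f n.

Lemma polyfun_cst a : polyfun (fun=> a).
Proof. by exists a%:P => n; rewrite hornerC. Qed.

Lemma polyfun_id : polyfun id.
Proof. by exists 'X => n; rewrite hornerX. Qed.

Lemma polyfunD f g : polyfun f -> polyfun g -> polyfun (fun n => f n + g n)%N.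
Proof. by move=> [p Hp] [q Hq]; exists (p + q) => n; rewrite hornerD Hp Hq. Qed.

Lemma polyfunM f g : polyfun f -> polyfun g -> polyfun (fun n => f n * g n)%N.
Proof. by move=> [p Hp] [q Hq]; exists (p * q) => n; rewrite hornerM Hp Hq. Qed.

Lemma polyfun_comp (p : {poly nat}) f : polyfun f -> polyfun (fun n => p.[f n]).
Proof. by move=> [q Hq]; exists (p \Po q) => n; rewrite horner_comp Hq. Qed.

Lemma leq_horner (p : {poly nat}) m n : (m <= n)%N -> (p.[m] <= p.[n])%N.
Proof.
move=> mn; rewrite !horner_coef.
apply: (big_ind2 (fun a b : nat => (a <= b)%N)) => // [a b c d|i _].
  exact: leq_add.
rewrite leq_mul2l; apply/orP; right.
have natX (a k : nat) : a ^+ k = (a ^ k)%N.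
  by elim: k => // k IHk; rewrite exprS IHk expnS.
by rewrite !natX; case: (val i) => // k; rewrite leq_exp2r.
Qed.

Lemma answer_inj : injective answer.
Proof. by case=> [x|] [y|] //= [->]. Qed.

Lemma ws_run Pi alg (pol : {poly nat})
    (Halg : forall I gamma, instance Pi I -> 0 < gamma -> exists o t,
      [/\ run alg (param_input Pi I gamma) (answer o) t,
          (t <= pol.[dsize I + qsize gamma])%N & ws_correct Pi I gamma o])
    I gamma w t : instance Pi I -> 0 < gamma ->
  run alg (param_input Pi I gamma) w t ->
  exists o, [/\ w = answer o, (t <= pol.[dsize I + qsize gamma])%N
              & ws_correct Pi I gamma o].
Proof.
move=> HI g0 Hw; have [ o [t' [Ht' t'p oc]]] := Halg I gamma HI g0.
by have [-> ->] := run_det Hw Ht'; exists o.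
Qed.

(** The supremum is over a bounded set: the polynomial of [alg] at [dsize I + Num.trunc l] is an
    upper bound. *)
Lemma le_T_ALG (R : realType) Pi alg I (l : R) gamma w t :
  ws_exact_polytime Pi alg -> instance Pi I -> 0 < gamma -> (qsize gamma)%:R <= l ->
  run alg (param_input Pi I gamma) w t -> t%:R <= T_ALG Pi alg I l.
Proof.
move=> [pol Halg] HI g0 gl Hw; apply: ub_le_sup; last by exists gamma, w, t.
exists (pol.[dsize I + Num.trunc l])%:R => _ [d [v [s [d0 dl Hv ->]]]].
have [ o [_ sp _]] := ws_run Halg HI d0 Hv.
rewrite ler_nat; apply: leq_trans sp _; apply: leq_horner; rewrite leq_add2l.
by rewrite truncn_ge_nat // (le_trans _ dl).
Qed.

(** A returned solution is no longer than the time spent by [alg], so evaluating it takes time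
    bounded by a composition of polynomials. *)
Lemma T_obj_set_ub (R : realType) Pi alg I (l : R) :
  ws_exact_polytime Pi alg -> instance Pi I ->
  has_ubound [set T | exists gamma x s i w t,
         [/\ 0 < gamma /\ (qsize gamma)%:R <= l,
             run alg (param_input Pi I gamma) (answer (Some x)) s,
             run (obj_prog Pi i) (Node I x) w t & T = t%:R :> R]].
Proof.
move=> [pol Halg] HI; have [pol' Hobj] := obj_polytime Pi.
exists (pol'.[dsize I + pol.[dsize I + Num.trunc l]])%:R.
move=> _ [d [x [s [i [w [t [[d0 dl] Hx Hw ->]]]]]]].
have [ o [/answer_inj <- sp [Fx _]]] := ws_run Halg HI d0 Hx.
have [t' Ht' t'p] := Hobj i I x HI Fx.
have [_ ->] := run_det Hw Ht'.
rewrite ler_nat; apply: leq_trans t'p _; apply: leq_horner; rewrite leq_add2l.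
have [_ /= xs] := run_size Hx.
apply: (@leq_trans s); first by apply: leq_trans xs; rewrite leq_addl.
apply: leq_trans sp _; apply: leq_horner; rewrite leq_add2l.
by rewrite truncn_ge_nat // (le_trans _ dl).
Qed.

Lemma le_T_obj (R : realType) Pi alg I (l : R) gamma x s i w t :
  ws_exact_polytime Pi alg -> instance Pi I -> 0 < gamma -> (qsize gamma)%:R <= l ->
  run alg (param_input Pi I gamma) (answer (Some x)) s ->
  run (obj_prog Pi i) (Node I x) w t -> t%:R <= T_obj Pi alg I l.
Proof.
move=> Halg HI g0 gl Hx Hw; apply: ub_le_sup; first exact: T_obj_set_ub.
by exists gamma, x, s, i, w, t.
Qed.

(** If [alg] returns no solution the set is empty, and [sup] takes its default value 0. *)
Lemma T_obj_ge0 (R : realType) Pi alg I (l : R) :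
  ws_exact_polytime Pi alg -> instance Pi I -> 0 <= T_obj Pi alg I l.
Proof.
move=> Halg HI; have ub := T_obj_set_ub l Halg HI; rewrite /T_obj.
set E := (X in sup X); have [[T ET]|nE] := pselect (E !=set0)%classic; last first.
  by rewrite sup_out // => -[].
apply: (le_trans _ (ub_le_sup ub ET)).
by case: ET => [d [x [s [i [w [t [_ _ _ ->]]]]]]].
Qed.

(** * Base-2 logarithms, dyadic rounding of [eps] and the number of search rounds *)

Lemma log2X2 (R : realType) n : log2 (2 ^+ n : R) = n%:R.
Proof.
have ln2 : 0 < ln (2 : R) by rewrite ln_gt0 // ltr1n.
by rewrite /log2 lnXn // -(mulr_natl (ln 2)) mulfK // gt_eqF.
Qed.

Lemma ler_log2 (R : realType) (x y : R) : 0 < x -> x <= y -> log2 x <= log2 y.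
Proof.
move=> x0 xy; rewrite /log2 ler_pM2r ?invr_gt0 ?ln_gt0 ?ltr1n //.
by rewrite ler_ln // posrE (lt_le_trans x0).
Qed.

Lemma log2V_ge0 (R : realType) (eps : R) : 0 < eps -> eps <= 1 -> 0 <= log2 (1 / eps).
Proof.
move=> e0 e1; have -> : 0 = log2 (2 ^+ 0 : R) by rewrite log2X2.
by apply: ler_log2; rewrite expr0 // div1r invf_ge1.
Qed.

(** Take the least [e] with [2 ^- e <= eps]: if [e > 0], then [e.-1] fails, which gives both other
    bounds; if [e = 0], they follow from [eps <= 1]. *)
Lemma dyadic_below (R : realType) (eps : R) : 0 < eps -> eps <= 1 ->
  exists e, [/\ 2 ^- e <= eps, eps <= 2 * 2 ^- e & e%:R <= log2 (1 / eps) + 1].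
Proof.
move=> e0 e1; have [n ne] : exists n, 2 ^- n <= eps.
  exists (Num.trunc eps^-1).+1; rewrite -[leRHS]invrK.
  rewrite lef_pV2 ?posrE ?invr_gt0 ?exprn_gt0 //.
  apply: ltW; apply: lt_le_trans (truncnS_gt _) _.
  by rewrite -natrX ler_nat ltnW // ltn_expl.
have exn : exists n, 2 ^- n <= eps by exists n.
case: (ex_minnP exn) => e ee emin; exists e; case: e => [|e] in ee emin *; split => //.
- by rewrite expr0 invr1 mulr1 (le_trans e1) // ler1n.
- by rewrite addr_ge0 ?log2V_ge0.
- have : eps < 2 ^- e by rewrite ltNge; apply/negP => /emin; rewrite ltnn.
  by rewrite exprS invfM mulrA divff // mul1r => /ltW.
- have : eps < 2 ^- e by rewrite ltNge; apply/negP => /emin; rewrite ltnn.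
  move=> /ltW ee'; rewrite -natr1 lerD2r -(log2X2 R e) ler_log2 ?exprn_gt0 //.
  by rewrite div1r -[leLHS]invrK lef_pV2 // posrE ?invr_gt0 ?exprn_gt0.
Qed.

(** Two logarithms of [2 ^+ (2 ^ k.-1) <= UB / LB] bound [k.-1] by the log factor, as
    [1 / eps >= 1]; the factor 3 absorbs the remaining 2. *)
Lemma leq_log_factor (R : realType) Pi (eps : R) I k : instance Pi I ->
  0 < eps -> eps <= 1 ->
  (forall i, (i < k)%N -> 2 ^+ (2 ^ i) <= UB Pi I crit2 / LB Pi I crit2) ->
  k.+1%:R <= 3 * log_factor Pi eps I.
Proof.
move=> HI e0 e1 Hk; rewrite /log_factor.
set z := log2 _; have z1 : 1 <= Num.max 1 z by rewrite le_max lexx.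
case: k Hk => [|k] Hk; first by lra.
suff kz : k%:R <= Num.max 1 z by rewrite -!natr1; lra.
rewrite le_max; apply/orP; right; rewrite -(log2X2 R k) /z ler_log2 ?exprn_gt0 //.
have := Hk k (ltnSn k); rewrite -(ler_rat R) rmorphXn /= ratr_nat => /ler_log2.
rewrite exprn_gt0 // log2X2 natrX => /(_ isT) /le_trans; apply.
have r0 : 0 < log2 (ratr (UB Pi I crit2 / LB Pi I crit2) : R).
  have := Hk k (ltnSn k); rewrite -(ler_rat R) rmorphXn /= ratr_nat => /ler_log2.
  by rewrite exprn_gt0 // log2X2 => /(_ isT); apply: lt_le_trans; rewrite ltr0n expn_gt0.
by rewrite ler_peMl ?(ltW r0) // div1r invf_ge1.
Qed.

Lemma inf_gtM (R : realType) (E : set R) (a b : R) : 0 < b -> (E !=set0)%classic ->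
  (forall z, E z -> a <= b * z) -> a <= b * inf E.
Proof.
move=> b0 E0 Eb; rewrite mulrC -ler_pdivrMr //; apply: lb_le_inf => // z Ez.
by rewrite ler_pdivrMr // mulrC Eb.
Qed.

(** [2 ^- e <= eps] yields the budget factor, and [eps <= 2 * 2 ^- e], that is [2 ^+ e <= 2 / eps],
    the cost factor. *)
Lemma grid_budget_correct (R : realType) Pi I B e (eps : R) o :
  instance Pi I -> 0 < B -> 0 < eps -> 2 ^- e <= eps -> eps <= 2 * 2 ^- e ->
  grid_correct Pi I B e o ->
  budget_correct (1 + 2 * eps) (1 + 2 / eps) Pi I B o.
Proof.
move=> HI B0 eps0 ee ee'; case: o => [x|//] [Fx Hx]; split => // -[y0 Fy0 y0B].
have p0 : 0 < 2 ^- e :> R by rewrite invr_gt0 exprn_gt0.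
have e2 : 2 ^+ e <= 2 / eps.
  by rewrite ler_pdivlMr // mulrC -ler_pdivlMr ?exprn_gt0.
split.
  have [xB _] := Hx y0 (conj Fy0 y0B).
  have : ratr (obj Pi crit1 I x) <= ratr (relaxed B e) :> R by rewrite ler_rat.
  move/le_trans; apply.
  rewrite /relaxed rmorphM rmorphD rmorph1 rmorphM fmorphV rmorphXn /= ratr_nat.
  by rewrite ler_wpM2r ?lerD2l ?ler_wpM2l // ler0q ltW.
apply: inf_gtM.
- by rewrite addr_gt0 // divr_gt0.
- by exists (ratr (obj Pi crit2 I y0)), y0.
move=> _ [y [Fy yB] <-]; have [_] := Hx y (conj Fy yB).
rewrite -(ler_rat R) rmorphM rmorphD rmorph1 rmorphXn /= ratr_nat => /le_trans; apply.
by rewrite ler_wpM2r ?lerD2l // ler0q ltW // obj_gt0.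
Qed.

Lemma polyfun_input Pi : exists2 f, polyfun f & forall I B, instance Pi I ->
  (dsize (param_input Pi I B) <= f (dsize I + qsize B)%N)%N.
Proof.
have [p Hp] := bounds_size Pi; exists (fun n => n + 10 + 4 * p.[n])%N.
  apply: polyfunD; last by apply: polyfunM; [exact: polyfun_cst|exists p].
  by apply: polyfunD; [exact: polyfun_id|exact: polyfun_cst].
move=> I B HI; have [l1 u1] := Hp I crit1 HI; have [l2 u2] := Hp I crit2 HI.
rewrite dsize_param_input.
by have := @leq_horner p (dsize I) (dsize I + qsize B) (leq_addr _ _); lia.
Qed.

Lemma ws_calls_polytime Pi alg K e : ws_exact_polytime Pi alg -> exists2 f, polyfun f &
  forall I, instance Pi I ->
  forall S gamma n, (dsize I <= n)%N -> (S <= n)%N ->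
    0 < gamma -> (qsize gamma <= K * (S + e))%N -> exists o,
     [/\ runs alg (param_input Pi I gamma) (answer o) (f n),
         ws_correct Pi I gamma o
       & forall x, o = Some x ->
         runs (obj_prog Pi crit1) (Node I x) (Atom (obj Pi crit1 I x)) (f n)].
Proof.
move=> [p Hp]; have [q Hq] := obj_polytime Pi.
pose A n := p.[n + K * (n + e)]%N.
have pA : polyfun A.
  apply: polyfun_comp; apply: polyfunD; first exact: polyfun_id.
  apply: polyfunM; first exact: polyfun_cst.
  by apply: polyfunD; [exact: polyfun_id|exact: polyfun_cst].
exists (fun n => A n + q.[n + A n])%N.
  by apply: polyfunD => //; apply: polyfun_comp; apply: polyfunD; first exact: polyfun_id.
move=> I HI S gamma n In Sn g0 gS; have [ o [t [Ht tp oc]]] := Hp I gamma HI g0.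
have tA : (t <= A n)%N.
  apply: leq_trans tp _; apply: leq_horner; apply: leq_add => //.
  by apply: leq_trans gS _; rewrite leq_mul2l leq_add2r Sn orbT.
exists o; split => //; first by exists t => //; apply: leq_trans tA (leq_addr _ _).
move=> x ox; move: oc Ht; rewrite ox => -[Fx _] Ht.
have [s Hs sq] := Hq crit1 I x HI Fx; exists s => //.
apply: leq_trans sq _; apply: leq_trans _ (leq_addl _ _).
apply: leq_horner; apply: leq_add => //.
have [_ /= xt] := run_size Ht; apply: leq_trans _ tA; apply: leq_trans xt.
by rewrite leq_addl.
Qed.
Theorem theorem8 (R : realType) (Pi : biproblem) (ALG : prog)
    (hALG : ws_exact_polytime Pi ALG) :
  exists C : R, 0 < C /\
  forall eps : R, 0 < eps -> eps <= 1 ->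
  exists P : prog,
    bicriteria_approx (1 + 2 * eps) (1 + 2 / eps) Pi P /\
    forall (I : data) (B : rat) (w : data) (t : nat),
      instance Pi I -> 0 < B -> run P (param_input Pi I B) w t ->
      let l := C * ((dsize (param_input Pi I B))%:R + log2 (1 / eps)) in
      t%:R <= C * (T_ALG Pi ALG I l + T_obj Pi ALG I l) * log_factor Pi eps I.
Proof.
have [K HK] := budget_prog_runs.
have K4 : (K <= 4 * K + 4)%N by clear; lia.
have K8 : (3 * K <= 8 * K + 8)%N by clear; lia.
exists (8 * K + 8)%:R; split; first by rewrite ltr0n addn_gt0 orbT.
move=> eps eps0 eps1; have [e [ee ee' elog]] := dyadic_below eps0 eps1.
exists (budget_prog ALG (obj_prog Pi crit1) e); split.
  split; [by rewrite lerDl mulr_ge0 // ltW|by rewrite lerDl divr_ge0 // ltW|].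
  have [F [pF HpF] HF] := polyfun_input Pi.
  have [f [pf Hpf] Hf] := ws_calls_polytime K e hALG.
  have pFF : polyfun F by exists pF.
  have [p Hp] : polyfun (fun n => K * (2 * F n * (F n + e + pf.[F n])))%N.
    apply: polyfunM; first exact: polyfun_cst.
    apply: polyfunM; first by apply: polyfunM => //; exact: polyfun_cst.
    apply: polyfunD; last exact: polyfun_comp.
    by apply: polyfunD => //; exact: polyfun_cst.
  exists p => I B HI B0; set S := dsize (param_input Pi I B).
  have SF := HF I B HI; rewrite -/S in SF; set n := (dsize I + qsize B)%N in SF *.
  have IS : (dsize I <= S)%N.
    by rewrite /S dsize_param_input; lia.
  pose N := (F n + e + pf.[F n])%N.
  have SN : (S + e <= N)%N by rewrite /N; lia.
  have fN : (f (F n) <= N)%N by rewrite -Hpf leq_addl.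
  have HN gamma : 0 < gamma -> (qsize gamma <= K * (S + e))%N -> exists o,
      [/\ runs ALG (param_input Pi I gamma) (answer o) N, ws_correct Pi I gamma o
        & forall x, o = Some x ->
          runs (obj_prog Pi crit1) (Node I x) (Atom (obj Pi crit1 I x)) N].
    move=> g0 gS; have [ o [Ho oc objc]] := Hf I HI S gamma _ (leq_trans IS SF) SF g0 gS.
    exists o; split; [exact: runsW Ho fN|exact: oc|].
    by move=> x /objc Hx; exact: runsW Hx fN.
  have [ o [k [[t Ht tK] kS _ corr]]] := HK Pi ALG I B e N HI B0 SN HN.
  exists o, t; split; [exact: Ht| |exact: grid_budget_correct corr].
  rewrite Hp; apply: leq_trans tK _; rewrite leq_mul2l; apply/orP; right.
  apply: leq_mul => //; by apply: leq_trans kS _; rewrite leq_mul2l SF orbT.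
move=> I B w t HI B0 Ht; cbv zeta; set l := (X in T_ALG _ _ _ X).
set S := dsize (param_input Pi I B) in l *.
set TA := T_ALG _ _ _ _; set TO := T_obj _ _ _ _.
have S1 : 1 <= S%:R :> R by rewrite ler1n dsize_gt0.
have lK : ((4 * K + 4) * (S + e))%:R <= l.
  rewrite /l (_ : 8 * K + 8 = (4 * K + 4) * 2)%N; last by ring.
  rewrite !natrM -mulrA ler_wpM2l // natrD.
  by have := log2V_ge0 eps0 eps1; move: elog; lra.
have TO0 : 0 <= TO by exact: T_obj_ge0.
have qTA gamma v s : 0 < gamma -> (qsize gamma <= (4 * K + 4) * (S + e))%N ->
    run ALG (param_input Pi I gamma) v s -> s%:R <= TA.
  move=> g0 gS; apply: le_T_ALG => //; apply: le_trans lK; by rewrite ler_nat.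
have [pol Halg] := hALG.
(* [ALG] has to read the weight [2 ^+ (S + e)]. *)
have STA : (S + e)%:R <= TA.
  have [ o [s [Hs _ _]]] := Halg I (2 ^+ (S + e)) HI (exprn_gt0 _ (ltr0n _ 2)).
  apply: le_trans (qTA _ _ _ _ _ Hs); last 2 first.
  - by rewrite exprn_gt0.
  - by rewrite qsizeX2; have := dsize_gt0 (param_input Pi I B); rewrite -/S mulnDl; lia.
  rewrite ler_nat; have [] := run_size Hs => + _; apply: leq_trans.
  have -> : dsize (param_input Pi I (2 ^+ (S + e))) =
    (1 + dsize (instance_input Pi I) + qsize (2 ^+ (S + e)))%N by [].
  by rewrite qsizeX2; lia.
have TA0 : 0 <= TA by apply: le_trans STA.
(* Running times are natural numbers, so they stay below the truncated suprema. *)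
pose N := (Num.trunc TA + Num.trunc TO)%N.
have SN : (S + e <= N)%N.
  by apply: leq_trans (leq_addr _ _); rewrite truncn_ge_nat.
have HN gamma : 0 < gamma -> (qsize gamma <= K * (S + e))%N -> exists o,
    [/\ runs ALG (param_input Pi I gamma) (answer o) N, ws_correct Pi I gamma o
      & forall x, o = Some x ->
        runs (obj_prog Pi crit1) (Node I x) (Atom (obj Pi crit1 I x)) N].
  move=> g0 gS; have [ o [s [Hs _ oc]]] := Halg I gamma HI g0.
  have gS' : (qsize gamma <= (4 * K + 4) * (S + e))%N.
    by apply: leq_trans gS _; rewrite leq_mul2r K4 orbT.
  exists o; split => //.
    exists s => //; apply: leq_trans (leq_addr _ _).
    by rewrite truncn_ge_nat // (qTA gamma _ _ g0 gS' Hs).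
  move=> x ox; rewrite ox in oc Hs; case: oc => Fx _.
  have [q Hq] := obj_polytime Pi; have [s' Hs' _] := Hq crit1 I x HI Fx.
  exists s' => //; apply: leq_trans (leq_addl _ _).
  rewrite truncn_ge_nat // (le_T_obj hALG HI g0 _ Hs Hs') //.
  by apply: le_trans lK; rewrite ler_nat.
have [ o [k [[t' Ht' tK] _ kr _]]] := HK Pi ALG I B e N HI B0 SN HN.
have [_ ->] := run_det Ht Ht'.
have kl := leq_log_factor HI eps0 eps1 kr.
have NT : N%:R <= TA + TO by rewrite natrD lerD ?truncn_le.
apply: (@le_trans _ _ (K * (k.+1 * N))%:R); first by rewrite ler_nat.
rewrite !natrM.
apply: (@le_trans _ _ (K%:R * (3 * log_factor Pi eps I * (TA + TO)))).
  by rewrite ler_wpM2l // ler_pM.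
have lf0 : 0 <= log_factor Pi eps I by rewrite /log_factor le_max ler01.
rewrite (_ : K%:R * _ = (3 * K)%:R * ((TA + TO) * log_factor Pi eps I)); last first.
  by rewrite natrM; ring.
by rewrite -mulrA ler_wpM2r ?mulr_ge0 ?addr_ge0 // ler_nat.
Qed.
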